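(* Let $r>0$ and set $$x = 4\left(\left(\lambda^{\ast}(r)\right)^2-\left(\lambda^{\ast}(r)\right)^4\right).$$ Suppose that there is a unique $y\in(-\tfrac12,0)$ such that $$\frac{64(y-1)y^3}{(8y-9)^3} = -\frac{27x}{(1-4x)^3},$$ and let $y$ denote this solution. Put \begin{align*} z &= 4y(1-y),\\ a &= \frac{\sqrt{9-8y}}{6\sqrt{(1-4x)^3}\,\big(27-36y+8y^2\big)}\cdot\Big[\,2(1-4x)\big(27-36y+8y^2\big)\,\alpha(r)\\ &\quad + 4x\Big(\big(27-36y+8y^2\big)-\big(16y-16y^2\big)\sqrt{1-x}\Big)\sqrt{r}\\ &\quad - \Big(\big(27-36y+8y^2\big)-\big(27-44y+16y^2\big)\sqrt{1-x}\Big)\sqrt{r}\,\Big],\\ b &= \tfrac13\sqrt{r}\,(1-2y). \end{align*} If $|z|<1$, then $$\frac1\pi=\sum_{n=0}^{\infty}\frac{\left(\frac13\right)_n\left(\frac12\right)_n\left(\frac23\right)_n}{(1)_n^3}\,z^n\,(a+bn).$$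
   Context: The Pochhammer symbol is $(u)_0=1$ and $(u)_n=u(u+1)\cdots(u+n-1)$ for $n\ge 1$; $(1)_n^3$ means $((1)_n)^3$. The complete elliptic integrals of the first and second kinds with modulus $k$ are $$\mathbf K(k)=\int_0^{\pi/2}\frac{d\theta}{\sqrt{1-k^2\sin^2\theta}},\qquad \mathbf E(k)=\int_0^{\pi/2}\sqrt{1-k^2\sin^2\theta}\,d\theta .$$ Write $k'=\sqrt{1-k^2}$, $\mathbf K'(k)=\mathbf K(k')$ and $\mathbf E'(k)=\mathbf E(k')$. For $r>0$, the elliptic lambda function is $\lambda^{\ast}(r)=k_r$, where $k_r\in(0,1)$ is the unique number with $\mathbf K'(k_r)/\mathbf K(k_r)=\sqrt r$. For $r>0$, the elliptic alpha function is $$\alpha(r)=\frac{\mathbf E'(k)}{\mathbf K(k)}-\frac{\pi}{4\,\mathbf K(k)^2}\quad\text{with } k=\lambda^{\ast}(r),$$ equivalently $\alpha(r)=\frac{\pi}{4\mathbf K(k)^2}-\sqrt r\left(\frac{\mathbf E(k)}{\mathbf K(k)}-1\right)$ with $k=\lambda^{\ast}(r)$.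
   Formalization: The formula is proved for r ≥ 1 instead of r > 0; for 0 < r < 1 the claim as printed fails, since x, y, z agree for r and 1/r: at r = 1/25 all hypotheses hold but the series sums to about 0.18727, not 1/π. *)

(* Defs.v *)
From Stdlib Require Import Reals ClassicalEpsilon.
From Coquelicot Require Import Coquelicot.
Open Scope R_scope.

Fixpoint pochhammer (u : R) (n : nat) : R :=
  match n with
  | O => 1
  | S m => pochhammer u m * (u + INR m)
  end.

(* The argument of [ellK] and [ellE] is the modulus k, not the parameter k^2. *)
Definition ellK (k : R) : R :=
  RInt (fun t => / sqrt (1 - k ^ 2 * sin t ^ 2)) 0 (PI / 2).

Definition ellE (k : R) : R :=
  RInt (fun t => sqrt (1 - k ^ 2 * sin t ^ 2)) 0 (PI / 2).

Definition ellK' (k : R) : R := ellK (sqrt (1 - k ^ 2)).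

Definition ellE' (k : R) : R := ellE (sqrt (1 - k ^ 2)).

Definition is_singular_modulus (r k : R) : Prop :=
  0 < k < 1 /\ ellK' k / ellK k = sqrt r.

(* For r > 0 there is exactly one singular modulus, so the choice is forced;
   for r <= 0 the value is arbitrary. *)
Definition lambda_star (r : R) : R :=
  epsilon (inhabits 0) (is_singular_modulus r).

Definition alpha (r : R) : R :=
  let k := lambda_star r in
  ellE' k / ellK k - PI / (4 * ellK k ^ 2).

(* Main.v *)
Require Import Defs.
From Stdlib Require Import Reals ClassicalEpsilon Lra.
From Coquelicot Require Import Coquelicot.
Open Scope R_scope.

(** Let m be the square of lambda_star r, let K and E be the complete
    integrals as functions of m, and let Phi be the hypergeometric series with
    upper parameters 1/3, 1/2, 2/3 and lower parameters 1, 1.  The sum to be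
    computed is a Phi(z) + b z Phi'(z).

    The heart of the matter is a transformation of degree three.  For
    0 < p < 1/4 put v = p (1 + p) and
      m = p^3 (2 + p) / (1 + 2 p),    y = - 27 v / (2 (1 - 2 v)^3).
    Then Phi (4 y (1 - y)) = g^2, where
      g = (1 - 2 v) / sqrt (1 + 2 p) * (2 K(m) / PI)
    ([cubic_transformation]).  With delta = y (1 - y) d/dy, the equation of K
    turns into delta^2 g = (2/9) y (1 - y) g, which is the equation of the
    series with parameters 1/3, 2/3; 1 in y.  By Clausen's formula
    Phi (4 y (1 - y)) satisfies the symmetric square of this equation, as does
    g^2.  The point y = 0 is singular, but both functions are regular there and
    take the value 1, and that determines the solution
    ([symmetric_square_unique]).  Applying delta to Phi = g^2 also expresses
    z Phi'(z) by K and E.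

    The equation between x and y in the theorem defines a rational curve: with
    x = 4 m (1 - m), its relevant branch is the one parametrized by p
    ([parametrize_solution]).  Finally, Legendre's relation gives
      alpha r = PI / (4 K^2) - sqrt r (E / K - 1)
    ([alpha_by_E]).  In a Phi(z) + b z Phi'(z) the term PI / (4 K^2)
    contributes 1 / PI, while the terms in sqrt r K^2 and sqrt r K E cancel
    ([ramanujan_identity]).  The assumption 1 <= r means m <= 1/2, so that
    sqrt (1 - x) = 1 - 2 m. *)

(** * Complete elliptic integrals as functions of the parameter *)

(** K and E are both of this form, so that one lemma differentiates them. *)
Definition quarter_integral (h : R -> R) (m : R) : R :=
  RInt (fun t => h (1 - m * sin t ^ 2)) 0 (PI / 2).

(** With m = k^2 this is [ellK] k; passing to the complementary modulus
    replaces m by 1 - m. *)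
Definition K (m : R) : R := quarter_integral (fun v => / sqrt v) m.
Definition E (m : R) : R := quarter_integral sqrt m.

Lemma sin_sqr_bounds t : 0 <= sin t ^ 2 <= 1.
Proof.
  pose proof (sin2_cos2 t) as H. unfold Rsqr in H.
  split; nra.
Qed.

Lemma radicand_pos m t : m < 1 -> 0 < 1 - m * sin t ^ 2.
Proof. intros hm. pose proof (sin_sqr_bounds t).
  destruct (Rle_lt_dec m 0); nra. Qed.

Lemma continuous_quarter_integrand (h : R -> R) m t :
  continuous h (1 - m * sin t ^ 2) ->
  continuous (fun t => h (1 - m * sin t ^ 2)) t.
Proof.
  intros hc. apply (continuous_comp (fun t => 1 - m * sin t ^ 2) h); [|exact hc].
  apply (ex_derive_continuous (fun t => 1 - m * sin t ^ 2)). auto_derive; easy.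
Qed.

Lemma is_RInt_quarter_integral (h : R -> R) m :
  m < 1 -> (forall v, 0 < v -> continuous h v) ->
  is_RInt (fun t => h (1 - m * sin t ^ 2)) 0 (PI / 2) (quarter_integral h m).
Proof.
  intros hm hc. apply (RInt_correct (V := R_CompleteNormedModule)).
  apply (ex_RInt_continuous (V := R_CompleteNormedModule)).
  intros t _. apply continuous_quarter_integrand, hc, radicand_pos, hm.
Qed.

Lemma continuous_of_is_derive_pos (h h' : R -> R) :
  (forall v, 0 < v -> is_derive h v (h' v)) ->
  forall v, 0 < v -> continuous h v.
Proof.
  intros hd v hv. apply (ex_derive_continuous h). exists (h' v). exact (hd v hv).
Qed.

Lemma is_derive_quarter_integral (h h' : R -> R) m :
  (forall v, 0 < v -> is_derive h v (h' v)) ->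
  (forall v, 0 < v -> continuous h' v) ->
  m < 1 ->
  is_derive (quarter_integral h) m
    (RInt (fun t => - sin t ^ 2 * h' (1 - m * sin t ^ 2)) 0 (PI / 2)).
Proof.
  intros hd hc hm.
  assert (hD : forall n t, n < 1 ->
    is_derive (fun n => h (1 - n * sin t ^ 2)) n
      (- sin t ^ 2 * h' (1 - n * sin t ^ 2))).
  { intros n t hn. apply (is_derive_comp h (fun n => 1 - n * sin t ^ 2)).
    - apply hd, radicand_pos, hn.
    - auto_derive; [easy|ring]. }
  assert (hloc : locally m (fun n => n < 1)).
  { apply (open_lt 1); exact hm. }
  rewrite (RInt_ext _ (fun t => Derive (fun n => h (1 - n * sin t ^ 2)) m)).
  2:{ intros t _. symmetry. apply is_derive_unique, hD, hm. }
  apply (is_derive_RInt_param (fun n t => h (1 - n * sin t ^ 2))).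
  - apply (filter_imp (fun n => n < 1)); [|exact hloc].
    intros n hn t _. eexists. apply hD, hn.
  - intros t _.
    apply continuity_2d_pt_ext_loc
      with (fun n t => - sin t ^ 2 * h' (1 - n * sin t ^ 2)).
    { destruct hloc as [d hd']. exists d. intros n s hn _.
      symmetry. apply is_derive_unique, hD, hd', hn. }
    assert (hs : continuity_2d_pt (fun _ s => sin s ^ 2) m t).
    { apply (continuity_1d_2d_pt_comp (fun s => sin s ^ 2) (fun _ s => s)).
      - apply continuity_pt_filterlim, (ex_derive_continuous (fun s => sin s ^ 2)).
        auto_derive; easy.
      - apply continuity_2d_pt_id2. }
    apply continuity_2d_pt_mult.
    + apply continuity_2d_pt_opp, hs.
    + apply continuity_1d_2d_pt_comp.
      * apply continuity_pt_filterlim, hc, radicand_pos, hm.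
      * apply continuity_2d_pt_minus; [apply continuity_2d_pt_const|].
        apply continuity_2d_pt_mult; [apply continuity_2d_pt_id1|exact hs].
  - apply (filter_imp (fun n => n < 1)); [|exact hloc].
    intros n hn. eexists. apply (is_RInt_quarter_integral h n hn).
    exact (continuous_of_is_derive_pos h h' hd).
Qed.

Lemma is_derive_sqrt_pos v : 0 < v -> is_derive sqrt v (/ (2 * sqrt v)).
Proof.
  intros hv. auto_derive; [lra|]. field.
  apply Rgt_not_eq, sqrt_lt_R0, hv.
Qed.

Lemma is_derive_inv_sqrt v :
  0 < v -> is_derive (fun v => / sqrt v) v (- / (2 * (v * sqrt v))).
Proof.
  intros hv. assert (hs := sqrt_lt_R0 v hv).
  auto_derive; [lra|].
  replace (v * sqrt v) with (sqrt v * sqrt v * sqrt v)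
    by (rewrite sqrt_sqrt; lra).
  field. lra.
Qed.

Lemma continuous_sqrt_pos v : 0 < v -> continuous sqrt v.
Proof. apply (continuous_of_is_derive_pos _ _ is_derive_sqrt_pos). Qed.

Lemma continuous_inv_sqrt v : 0 < v -> continuous (fun v => / sqrt v) v.
Proof. apply (continuous_of_is_derive_pos _ _ is_derive_inv_sqrt). Qed.

Lemma continuous_inv_sqrt_cube v :
  0 < v -> continuous (fun v => / (v * sqrt v)) v.
Proof.
  intros hv. assert (hs := sqrt_lt_R0 v hv).
  apply (ex_derive_continuous (fun v => / (v * sqrt v))).
  auto_derive. split; [lra|split; [|easy]].
  apply Rgt_not_eq. apply Rmult_lt_0_compat; lra.
Qed.

Lemma is_RInt_K m :
  m < 1 -> is_RInt (fun t => / sqrt (1 - m * sin t ^ 2)) 0 (PI / 2) (K m).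
Proof.
  intros hm. apply (is_RInt_quarter_integral (fun v => / sqrt v) m hm).
  exact continuous_inv_sqrt.
Qed.

Lemma is_RInt_E m :
  m < 1 -> is_RInt (fun t => sqrt (1 - m * sin t ^ 2)) 0 (PI / 2) (E m).
Proof.
  intros hm. apply (is_RInt_quarter_integral sqrt m hm).
  exact continuous_sqrt_pos.
Qed.

(** With v = 1 - m sin^2 t, the derivative of m sin t cos t / sqrt v is
    sqrt v - (1 - m) / (v sqrt v), and this primitive vanishes at both ends. *)
Lemma quarter_integral_inv_sqrt_cube m :
  m < 1 ->
  is_RInt (fun t => / ((1 - m * sin t ^ 2) * sqrt (1 - m * sin t ^ 2)))
    0 (PI / 2) (E m / (1 - m)).
Proof.
  intros hm.
  assert (hB : is_RInt
    (fun t => sqrt (1 - m * sin t ^ 2)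
       - (1 - m) * / ((1 - m * sin t ^ 2) * sqrt (1 - m * sin t ^ 2)))
    0 (PI / 2) 0).
  { replace 0 with
      (minus (m * sin (PI / 2) * cos (PI / 2) / sqrt (1 - m * sin (PI / 2) ^ 2))
             (m * sin 0 * cos 0 / sqrt (1 - m * sin 0 ^ 2))) at 2.
    2:{ rewrite cos_PI2, sin_0. unfold minus, plus, opp; simpl.
        unfold Rdiv; ring. }
    apply (is_RInt_derive (V := R_CompleteNormedModule)
      (fun t => m * sin t * cos t / sqrt (1 - m * sin t ^ 2))); intros t _;
      assert (hv := radicand_pos m t hm);
      assert (hs := sqrt_lt_R0 _ hv).
    - auto_derive.
      { split; [exact hv|]. split; [|easy]. apply Rgt_not_eq, sqrt_lt_R0, hv. }
      replace (1 + - (m * (sin t * (sin t * 1)))) with (1 - m * sin t ^ 2) by ring.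
      assert (hc : cos t * cos t = 1 - sin t ^ 2).
      { pose proof (sin2_cos2 t) as hsc. unfold Rsqr in hsc. lra. }
      set (q := sqrt (1 - m * sin t ^ 2)) in *.
      assert (hq : 1 - m * sin t ^ 2 = q * q).
      { unfold q. rewrite sqrt_sqrt; lra. }
      rewrite hq.
      assert (hq0 : q <> 0) by lra.
      apply (Rmult_eq_reg_r (q * q * q)).
      2:{ repeat apply Rmult_integral_contrapositive_currified; exact hq0. }
      field_simplify; [|exact hq0|exact hq0].
      replace (cos t ^ 2) with (1 - sin t ^ 2) by (rewrite <- hc; ring).
      replace (q ^ 4) with ((1 - m * sin t ^ 2) ^ 2) by (rewrite hq; ring).
      replace (q ^ 2) with (1 - m * sin t ^ 2) by (rewrite hq; ring).
      field.
    - apply (continuous_minus (V := R_NormedModule)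
        (fun t => sqrt (1 - m * sin t ^ 2))).
      + apply (continuous_quarter_integrand sqrt).
        apply continuous_sqrt_pos, hv.
      + apply (continuous_scal_r (V := R_NormedModule) (1 - m)
         (fun t => / ((1 - m * sin t ^ 2) * sqrt (1 - m * sin t ^ 2)))).
        apply (continuous_quarter_integrand (fun v => / (v * sqrt v))).
        apply continuous_inv_sqrt_cube, hv. }
  generalize (is_RInt_scal _ _ _ (/ (1 - m)) _
    (is_RInt_minus _ _ _ _ _ _ (is_RInt_E m hm) hB)).
  unfold scal, minus, plus, opp; simpl. unfold mult; simpl.
  intros H.
  replace (E m / (1 - m)) with (/ (1 - m) * (E m + - 0)) by (field; lra).
  eapply is_RInt_ext; [|exact H].
  intros t _. simpl.
  assert (hv := radicand_pos m t hm). simpl in hv.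
  assert (hs := sqrt_lt_R0 _ hv).
  field. lra.
Qed.

Lemma is_derive_E m :
  m < 1 -> m <> 0 -> is_derive E m ((E m - K m) / (2 * m)).
Proof.
  intros hm hm0.
  replace ((E m - K m) / (2 * m)) with
    (RInt (fun t => - sin t ^ 2 * / (2 * sqrt (1 - m * sin t ^ 2))) 0 (PI / 2)).
  { apply (is_derive_quarter_integral sqrt (fun v => / (2 * sqrt v))); trivial.
    - exact is_derive_sqrt_pos.
    - intros v hv. assert (hs := sqrt_lt_R0 v hv).
      apply (ex_derive_continuous (fun v => / (2 * sqrt v))).
      auto_derive. split; lra. }
  apply is_RInt_unique.
  generalize (is_RInt_scal _ _ _ (/ (2 * m)) _
    (is_RInt_minus _ _ _ _ _ _ (is_RInt_E m hm) (is_RInt_K m hm))).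
  unfold scal, minus, plus, opp; simpl. unfold mult; simpl.
  intros H.
  replace ((E m - K m) / (2 * m)) with (/ (2 * m) * (E m + - K m))
    by (field; lra).
  eapply is_RInt_ext; [|exact H].
  intros t _.
  assert (hv := radicand_pos m t hm).
  assert (hs := sqrt_lt_R0 _ hv).
  assert (hq : sqrt (1 - m * sin t ^ 2) * sqrt (1 - m * sin t ^ 2)
     = 1 - m * sin t ^ 2) by (apply sqrt_sqrt; lra).
  simpl in *. set (q := sqrt _) in *.
  replace (q + - / q) with ((q * q - 1) / q) by (field; lra).
  rewrite hq. field. lra.
Qed.

(** The integral form of the derivative also covers m = 0, where the closed
    form of [is_derive_K] is 0 / 0. *)
Lemma is_derive_K_at_any m :
  m < 1 ->
  is_derive K m
    (RInt (fun t => - sin t ^ 2 *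
        - / (2 * ((1 - m * sin t ^ 2) * sqrt (1 - m * sin t ^ 2)))) 0 (PI / 2)).
Proof.
  intros hm.
  apply (is_derive_quarter_integral (fun v => / sqrt v)
           (fun v => - / (2 * (v * sqrt v)))); trivial.
  - exact is_derive_inv_sqrt.
  - intros v hv. assert (hs := sqrt_lt_R0 v hv).
    apply (ex_derive_continuous (fun v => - / (2 * (v * sqrt v)))).
    auto_derive. split; [lra|split; [|easy]].
    assert (0 < v * sqrt v) by (apply Rmult_lt_0_compat; lra). lra.
Qed.

Lemma is_derive_K m :
  m < 1 -> m <> 0 ->
  is_derive K m ((E m - (1 - m) * K m) / (2 * m * (1 - m))).
Proof.
  intros hm hm0.
  generalize (is_derive_K_at_any m hm). intros HD.
  replace ((E m - (1 - m) * K m) / (2 * m * (1 - m))) with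
    (RInt (fun t => - sin t ^ 2 *
        - / (2 * ((1 - m * sin t ^ 2) * sqrt (1 - m * sin t ^ 2)))) 0 (PI / 2));
    [exact HD|].
  apply is_RInt_unique.
  generalize (is_RInt_scal _ _ _ (/ (2 * m)) _
    (is_RInt_minus _ _ _ _ _ _
       (quarter_integral_inv_sqrt_cube m hm) (is_RInt_K m hm))).
  unfold scal, minus, plus, opp; simpl. unfold mult; simpl.
  intros H.
  replace ((E m - (1 - m) * K m) / (2 * m * (1 - m)))
    with (/ (2 * m) * (E m / (1 - m) + - K m)) by (field; lra).
  eapply is_RInt_ext; [|exact H].
  intros t _.
  assert (hv := radicand_pos m t hm).
  assert (hs := sqrt_lt_R0 _ hv). simpl in *.
  field. lra.
Qed.

Lemma ex_derive_K m : m < 1 -> ex_derive K m.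
Proof. intros hm. eexists. apply is_derive_K_at_any, hm. Qed.

Lemma ex_derive_E m : m < 1 -> ex_derive E m.
Proof.
  intros hm. eexists.
  apply (is_derive_quarter_integral sqrt (fun v => / (2 * sqrt v))); trivial.
  - exact is_derive_sqrt_pos.
  - intros v hv. assert (hs := sqrt_lt_R0 v hv).
    apply (ex_derive_continuous (fun v => / (2 * sqrt v))).
    auto_derive. split; lra.
Qed.

Lemma K_0 : K 0 = PI / 2.
Proof.
  unfold K, quarter_integral.
  rewrite (RInt_ext _ (fun _ => 1)).
  - rewrite RInt_const. unfold scal; simpl; unfold mult; simpl. ring.
  - intros t _. rewrite Rmult_0_l, Rminus_0_r, sqrt_1. apply Rinv_1.
Qed.

Lemma E_0 : E 0 = PI / 2.
Proof.
  unfold E, quarter_integral.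
  rewrite (RInt_ext _ (fun _ => 1)).
  - rewrite RInt_const. unfold scal; simpl; unfold mult; simpl. ring.
  - intros t _. rewrite Rmult_0_l, Rminus_0_r. apply sqrt_1.
Qed.

Lemma K_strictly_increasing m n : m < n -> n < 1 -> K m < K n.
Proof.
  intros hmn hn. pose proof PI_RGT_0.
  apply RInt_lt; [lra| | |].
  - intros t _. apply (continuous_quarter_integrand (fun v => / sqrt v)).
    apply continuous_inv_sqrt, radicand_pos, hn.
  - intros t _. apply (continuous_quarter_integrand (fun v => / sqrt v)).
    apply continuous_inv_sqrt, radicand_pos. lra.
  - intros t ht. assert (hst : 0 < sin t) by (apply sin_gt_0; lra).
    assert (hn' := radicand_pos n t hn).
    apply Rinv_lt_contravar.
    + apply Rmult_lt_0_compat; apply sqrt_lt_R0, radicand_pos; lra.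
    + apply sqrt_lt_1_alt.
      assert (0 < sin t ^ 2) by (apply pow_lt, hst). split; [lra|]. nra.
Qed.

Lemma K_increasing m n : m <= n -> n < 1 -> K m <= K n.
Proof.
  intros [hlt|heq] hn; [left; apply K_strictly_increasing; assumption|].
  right. rewrite heq. reflexivity.
Qed.

Lemma K_pos m : 0 <= m < 1 -> 0 < K m.
Proof.
  intros hm. pose proof PI_RGT_0. pose proof (K_increasing 0 m).
  rewrite K_0 in *. lra.
Qed.

(** * Legendre's relation *)

Lemma K_le_inv_sqrt m : 0 <= m < 1 -> K m <= PI / 2 * / sqrt (1 - m).
Proof.
  intros hm. pose proof PI_RGT_0.
  replace (PI / 2 * / sqrt (1 - m))
    with (RInt (fun _ => / sqrt (1 - m)) 0 (PI / 2)).
  2:{ rewrite RInt_const. unfold scal; simpl; unfold mult; simpl. ring. }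
  apply RInt_le; [lra| | |].
  - eexists. apply is_RInt_K. lra.
  - apply ex_RInt_const.
  - intros t _. pose proof (sin_sqr_bounds t).
    apply Rinv_le_contravar; [apply sqrt_lt_R0; lra|].
    apply sqrt_le_1_alt. nra.
Qed.

Lemma K_minus_E_bounds m : 0 <= m < 1 -> 0 <= K m - E m <= m * K m.
Proof.
  intros hm. pose proof PI_RGT_0.
  assert (hK := is_RInt_K m ltac:(lra)).
  assert (hE := is_RInt_E m ltac:(lra)).
  assert (hb : forall t, 0 <= / sqrt (1 - m * sin t ^ 2) - sqrt (1 - m * sin t ^ 2)
                 <= m * / sqrt (1 - m * sin t ^ 2)).
  { intros t. assert (hv := radicand_pos m t ltac:(lra)).
    pose proof (sin_sqr_bounds t).
    assert (hs := sqrt_lt_R0 _ hv).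
    assert (hq : sqrt (1 - m * sin t ^ 2) * sqrt (1 - m * sin t ^ 2)
       = 1 - m * sin t ^ 2) by (apply sqrt_sqrt; lra).
    set (q := sqrt _) in *.
    replace (/ q - q) with ((1 - q * q) * / q) by (field; lra).
    rewrite hq.
    assert (0 < / q) by (apply Rinv_0_lt_compat; lra).
    split; [apply Rmult_le_pos|apply Rmult_le_compat_r]; nra. }
  split.
  - enough (E m <= K m) by lra.
    apply (is_RInt_le _ _ 0 (PI / 2) _ _ ltac:(lra) hE hK).
    intros t _. specialize (hb t). lra.
  - enough (K m + opp (E m) <= m * K m) by (unfold opp in *; simpl in *; lra).
    apply (is_RInt_le _ _ 0 (PI / 2) _ _ ltac:(lra)
            (is_RInt_minus _ _ _ _ _ _ hK hE) (is_RInt_scal _ _ _ m _ hK)).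
    intros t _. specialize (hb t).
    unfold minus, plus, opp, scal; simpl; unfold mult; simpl.
    simpl in hb. lra.
Qed.

Lemma E_bounds m : 0 <= m < 1 -> 1 <= E m <= 1 + PI / 2 * sqrt (1 - m).
Proof.
  intros hm. pose proof PI_RGT_0.
  assert (hE := is_RInt_E m ltac:(lra)).
  assert (hC : is_RInt cos 0 (PI / 2) 1).
  { replace 1 with (minus (sin (PI / 2)) (sin 0)).
    2:{ rewrite sin_PI2, sin_0. unfold minus, plus, opp; simpl. ring. }
    apply (is_RInt_derive (V := R_CompleteNormedModule) sin cos).
    - intros t _. apply is_derive_sin.
    - intros t _. apply continuous_cos. }
  assert (hq := sqrt_pos (1 - m)).
  assert (hqq : sqrt (1 - m) * sqrt (1 - m) = 1 - m) by (apply sqrt_sqrt; lra).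
  assert (hb : forall t, 0 < t < PI / 2 ->
     cos t <= sqrt (1 - m * sin t ^ 2) <= cos t + sqrt (1 - m)).
  { intros t ht. assert (0 <= cos t) by (apply cos_ge_0; lra).
    pose proof (sin_sqr_bounds t).
    pose proof (sin2_cos2 t) as hsc. unfold Rsqr in hsc.
    assert (hv := radicand_pos m t ltac:(lra)).
    split.
    - rewrite <- (sqrt_Rsqr (cos t)) by assumption.
      apply sqrt_le_1_alt. unfold Rsqr. nra.
    - rewrite <- (sqrt_Rsqr (cos t + sqrt (1 - m))) by lra.
      apply sqrt_le_1_alt. unfold Rsqr. nra. }
  split.
  - apply (is_RInt_le _ _ 0 (PI / 2) _ _ ltac:(lra) hC hE).
    intros t ht. apply hb, ht.
  - replace (1 + PI / 2 * sqrt (1 - m))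
      with (plus 1 (scal (PI / 2 - 0) (sqrt (1 - m)))).
    2:{ unfold plus, scal; simpl; unfold mult; simpl. ring. }
    apply (is_RInt_le _ _ 0 (PI / 2) _ _ ltac:(lra) hE
             (is_RInt_plus _ _ _ _ _ _ hC (is_RInt_const _ _ (sqrt (1 - m))))).
    intros t ht. unfold plus; simpl. apply hb, ht.
Qed.

Definition legendre_form (m : R) : R :=
  E m * K (1 - m) + E (1 - m) * K m - K m * K (1 - m).

Lemma is_derive_legendre_form m :
  0 < m < 1 -> is_derive legendre_form m 0.
Proof.
  intros hm. unfold legendre_form.
  assert (h1 := is_derive_K m ltac:(lra) ltac:(lra)).
  assert (h2 := is_derive_E m ltac:(lra) ltac:(lra)).
  assert (h3 := is_derive_K (1 - m) ltac:(lra) ltac:(lra)).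
  assert (h4 := is_derive_E (1 - m) ltac:(lra) ltac:(lra)).
  auto_derive.
  - repeat split; eexists; eassumption.
  - change (fun x => K x) with K. change (fun x => E x) with E.
    replace (1 + - m) with (1 - m) by ring.
    rewrite (is_derive_unique K _ _ h1), (is_derive_unique E _ _ h2),
      (is_derive_unique K _ _ h3), (is_derive_unique E _ _ h4).
    field. lra.
Qed.

(** Written as (E - K) K' + E' K, the form tends to 1 * (PI / 2) at 0:
    K' grows at most like 1 / sqrt m whereas K - E is at most m K. *)
Lemma legendre_form_near_0 m :
  0 < m <= 1 / 2 ->
  Rabs (legendre_form m - PI / 2) <= (PI ^ 2 + PI) * sqrt m.
Proof.
  intros hm. pose proof PI_RGT_0.
  set (s := sqrt m).
  assert (hs : 0 < s) by (apply sqrt_lt_R0; lra).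
  assert (hss : s * s = m) by (apply sqrt_sqrt; lra).
  assert (hs1 : s < 1) by nra.
  destruct (K_minus_E_bounds m ltac:(lra)) as [hKE0 hKE1].
  destruct (E_bounds (1 - m) ltac:(lra)) as [hE0 hE1].
  assert (hK' := K_le_inv_sqrt (1 - m) ltac:(lra)).
  assert (hK'0 := K_pos (1 - m) ltac:(lra)).
  replace (1 - (1 - m)) with m in * by ring. fold s in hE1, hK'.
  assert (hK0 := K_increasing 0 m ltac:(lra) ltac:(lra)). rewrite K_0 in hK0.
  assert (hK1 : K m <= PI / 2 * (1 + 2 * s)).
  { apply Rle_trans with (1 := K_le_inv_sqrt m ltac:(lra)).
    apply Rmult_le_compat_l; [lra|].
    assert (h1 : 1 - m <= sqrt (1 - m)).
    { rewrite <- (sqrt_Rsqr (1 - m)) at 1 by lra.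
      apply sqrt_le_1_alt. unfold Rsqr. nra. }
    apply Rle_trans with (/ (1 - m)).
    - apply Rinv_le_contravar; lra.
    - apply Rmult_le_reg_l with (1 - m); [lra|]. rewrite Rinv_r by lra. nra. }
  assert (hK2 : K m <= PI).
  { apply Rle_trans with (K (1 / 2)); [apply K_increasing; lra|].
    apply Rle_trans with (1 := K_le_inv_sqrt (1 / 2) ltac:(lra)).
    assert (h2 : 1 / 2 <= sqrt (1 - 1 / 2)).
    { rewrite <- (sqrt_Rsqr (1 / 2)) at 1 by lra.
      apply sqrt_le_1_alt. unfold Rsqr. lra. }
    apply Rle_trans with (PI / 2 * / (1 / 2)).
    - apply Rmult_le_compat_l; [lra|]. apply Rinv_le_contravar; lra.
    - right. field. }
  assert (hP : 0 <= (K m - E m) * K (1 - m) <= PI * (PI / 2) * s).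
  { split; [apply Rmult_le_pos; lra|].
    apply Rle_trans with (m * PI * (PI / 2 * / s)).
    - apply Rmult_le_compat; try lra. nra.
    - right. rewrite <- hss. field. lra. }
  assert (hQ : 0 <= (E (1 - m) - 1) * K m <= PI / 2 * s * PI).
  { split; [apply Rmult_le_pos; lra|]. apply Rmult_le_compat; lra. }
  unfold legendre_form.
  apply Rabs_le. nra.
Qed.

(** The form is constant by [is_derive_legendre_form], and
    [legendre_form_near_0] makes it arbitrarily close to PI / 2. *)
Lemma legendre_relation m : 0 < m < 1 -> legendre_form m = PI / 2.
Proof.
  intros hm. pose proof PI_RGT_0.
  assert (hconst : forall n, 0 < n < m -> legendre_form n = legendre_form m).
  { intros n hn. apply (eq_is_derive (V := R_NormedModule)); [|lra].
    intros t ht. apply is_derive_legendre_form. lra. }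
  destruct (Req_dec (legendre_form m) (PI / 2)) as [h|h]; [exact h|exfalso].
  set (d := Rabs (legendre_form m - PI / 2)).
  assert (hd : 0 < d) by (apply Rabs_pos_lt; lra).
  set (C := PI ^ 2 + PI).
  assert (hC : 0 < C) by (unfold C; nra).
  (* At s^2 the bound of legendre_form_near_0 is C s, at most d / 2. *)
  set (s := Rmin (m / 2) (d / (2 * C))).
  assert (hq : 0 < d / (2 * C)) by (apply Rdiv_lt_0_compat; lra).
  assert (hs : 0 < s <= m / 2 /\ s <= d / (2 * C)).
  { unfold s. repeat split; [apply Rmin_glb_lt; lra|apply Rmin_l|apply Rmin_r]. }
  destruct hs as [hs1 hs2].
  assert (hb := legendre_form_near_0 (s * s) ltac:(nra)).
  rewrite hconst in hb by nra.
  rewrite sqrt_square in hb by lra. fold C d in hb.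
  assert (C * s <= C * (d / (2 * C))) by (apply Rmult_le_compat_l; lra).
  replace (C * (d / (2 * C))) with (d / 2) in * by (field; lra).
  lra.
Qed.

(** * The singular modulus and the alpha function *)

(** After reflection of t, the radicand sin^2 + m cos^2 is at most
    (t + sqrt m)^2.  The logarithmic growth makes the period ratio unbounded
    near m = 0. *)
Lemma K_complement_lower_bound m :
  0 < m < 1 -> ln (PI / 2 / sqrt m) <= K (1 - m).
Proof.
  intros hm. pose proof PI_RGT_0.
  assert (hs : 0 < sqrt m) by (apply sqrt_lt_R0; lra).
  assert (hss : sqrt m * sqrt m = m) by (apply sqrt_sqrt; lra).
  set (s := sqrt m) in *.
  assert (hI : is_RInt (fun t => / (PI / 2 + s - t)) 0 (PI / 2)
                 (minus (- ln (PI / 2 + s - PI / 2)) (- ln (PI / 2 + s - 0)))).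
  { apply (is_RInt_derive (V := R_CompleteNormedModule)
             (fun t => - ln (PI / 2 + s - t))); intros t ht;
      rewrite Rmin_left, Rmax_right in ht by lra.
    - auto_derive; [lra|]. field. lra.
    - apply (ex_derive_continuous (fun t => / (PI / 2 + s - t))).
      auto_derive. lra. }
  apply Rle_trans with (minus (- ln (PI / 2 + s - PI / 2)) (- ln (PI / 2 + s - 0))).
  - unfold minus, plus, opp; simpl.
    replace (PI / 2 + s - PI / 2) with s by ring.
    rewrite ln_div by lra.
    assert (ln (PI / 2) <= ln (PI / 2 + s - 0)) by (apply ln_le; lra).
    lra.
  - apply (is_RInt_le _ _ 0 (PI / 2) _ _ ltac:(lra) hI
             (is_RInt_K (1 - m) ltac:(lra))).
    intros t ht.
    assert (hv := radicand_pos (1 - m) t ltac:(lra)).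
    apply Rinv_le_contravar; [apply sqrt_lt_R0, hv|].
    rewrite <- (sqrt_Rsqr (PI / 2 + s - t)) by lra.
    apply sqrt_le_1_alt. unfold Rsqr.
    pose proof (sin_sqr_bounds t).
    pose proof (sin2_cos2 t) as hsc. unfold Rsqr in hsc.
    assert (hc : 0 <= cos t <= PI / 2 - t).
    { split; [apply cos_ge_0; lra|].
      rewrite cos_sin, <- (sin_PI_x (PI / 2 + t)).
      replace (PI - (PI / 2 + t)) with (PI / 2 - t) by field.
      apply Rlt_le, sin_lt_x. lra. }
    nra.
Qed.

Definition period_ratio (m : R) : R := K (1 - m) / K m.

Lemma continuous_period_ratio m : 0 < m < 1 -> continuous period_ratio m.
Proof.
  intros hm. assert (hK := K_pos m ltac:(lra)).
  assert (h1 := is_derive_K m ltac:(lra) ltac:(lra)).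
  assert (h2 := is_derive_K (1 - m) ltac:(lra) ltac:(lra)).
  apply (ex_derive_continuous period_ratio). unfold period_ratio.
  auto_derive. repeat split; [eexists; exact h2|eexists; exact h1|lra].
Qed.

Lemma period_ratio_ge_1 m : 0 < m < 1 -> 1 <= period_ratio m -> m <= 1 / 2.
Proof.
  intros hm h. destruct (Rle_lt_dec m (1 / 2)) as [hle|hlt]; [exact hle|].
  exfalso. assert (hK := K_pos m ltac:(lra)).
  assert (hlt' := K_strictly_increasing (1 - m) m ltac:(lra) ltac:(lra)).
  apply (Rmult_le_compat_r (K m)) in h; [|lra].
  unfold period_ratio in h.
  replace (K (1 - m) / K m * K m) with (K (1 - m)) in h by (field; lra).
  lra.
Qed.

(** The ratio is 1 at m = 1/2 and unbounded near 0, so the intermediate value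
    theorem applies. *)
Lemma period_ratio_surjective q :
  1 <= q -> exists m, 0 < m < 1 /\ period_ratio m = q.
Proof.
  intros hq. pose proof PI2_1.
  assert (h0 : PI / 2 <= K (1 / 2)) by (rewrite <- K_0; apply K_increasing; lra).
  assert (hhalf : period_ratio (1 / 2) = 1).
  { unfold period_ratio. replace (1 - 1 / 2) with (1 / 2) by field. field. lra. }
  destruct (Req_dec q 1) as [h1|h1].
  { exists (1 / 2). split; [lra|]. congruence. }
  (* At m = exp (- 2 T) the ratio is at least T / K (1 / 2) = q + 1. *)
  set (T := (q + 1) * K (1 / 2)). set (s := exp (- T)).
  assert (hT : 2 <= T) by (unfold T; nra).
  assert (hs : 0 < s) by apply exp_pos.
  assert (hs2 : s < 1 / 2).
  { unfold s. rewrite exp_Ropp. pose proof (exp_ineq1 T ltac:(lra)).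
    apply Rlt_le_trans with (/ (1 + T)); [apply Rinv_lt_contravar; nra|].
    replace (1 / 2) with (/ 2) by field. apply Rinv_le_contravar; lra. }
  assert (hbig : q < period_ratio (s * s)).
  { assert (hK := K_pos (s * s) ltac:(nra)).
    assert (hK2 := K_increasing (s * s) (1 / 2) ltac:(nra) ltac:(lra)).
    assert (hl := K_complement_lower_bound (s * s) ltac:(nra)).
    rewrite sqrt_square in hl by lra.
    rewrite ln_div in hl by lra. unfold s at 1 in hl. rewrite ln_exp in hl.
    assert (0 < ln (PI / 2)) by (rewrite <- ln_1; apply ln_increasing; lra).
    unfold period_ratio. apply (Rmult_lt_reg_r (K (s * s))); [lra|].
    replace (K (1 - s * s) / K (s * s) * K (s * s)) with (K (1 - s * s))
      by (field; lra).
    unfold T in hl. nra. }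
  destruct (Ranalysis5.IVT_interv (fun m => q - period_ratio m) (s * s) (1 / 2))
    as [m [hm hm']].
  - intros m hm. apply continuity_pt_filterlim.
    apply (continuous_minus (V := R_NormedModule) (fun _ => q) period_ratio).
    + apply continuous_const.
    + apply continuous_period_ratio. nra.
  - nra.
  - lra.
  - rewrite hhalf. lra.
  - exists m. split; [nra|lra].
Qed.

Lemma lambda_star_spec r : 1 <= r -> is_singular_modulus r (lambda_star r).
Proof.
  intros hr. unfold lambda_star. apply epsilon_spec.
  destruct (period_ratio_surjective (sqrt r)) as [m [hm hq]].
  { rewrite <- sqrt_1. apply sqrt_le_1_alt, hr. }
  assert (hs : 0 < sqrt m) by (apply sqrt_lt_R0; lra).
  exists (sqrt m). split.
  - split; [exact hs|]. rewrite <- sqrt_1. apply sqrt_lt_1_alt. lra.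
  - change (K (sqrt (1 - sqrt m ^ 2) ^ 2) / K (sqrt m ^ 2) = sqrt r).
    rewrite !pow2_sqrt by (rewrite ?pow2_sqrt; lra).
    exact hq.
Qed.

Lemma lambda_star_sqr_bounds r : 1 <= r -> 0 < lambda_star r ^ 2 <= 1 / 2.
Proof.
  intros hr. destruct (lambda_star_spec r hr) as [hk hq].
  set (k := lambda_star r) in *.
  assert (hm : 0 < k ^ 2 < 1) by nra.
  split; [lra|]. apply period_ratio_ge_1; [exact hm|].
  change (K (sqrt (1 - k ^ 2) ^ 2) / K (k ^ 2) = sqrt r) in hq.
  rewrite pow2_sqrt in hq by lra.
  unfold period_ratio. rewrite hq, <- sqrt_1. apply sqrt_le_1_alt, hr.
Qed.

(** Legendre's relation, after K' is replaced by sqrt r K. *)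
Lemma alpha_by_E r :
  1 <= r ->
  let m := lambda_star r ^ 2 in
  alpha r = PI / (4 * K m ^ 2) - sqrt r * (E m / K m - 1).
Proof.
  intros hr m. assert (hm := lambda_star_sqr_bounds r hr).
  destruct (lambda_star_spec r hr) as [hk hq].
  unfold alpha. set (k := lambda_star r) in *.
  change (K (sqrt (1 - k ^ 2) ^ 2) / K (k ^ 2) = sqrt r) in hq.
  change (E (sqrt (1 - k ^ 2) ^ 2) / K (k ^ 2) - PI / (4 * K (k ^ 2) ^ 2)
          = PI / (4 * K m ^ 2) - sqrt r * (E m / K m - 1)).
  rewrite pow2_sqrt in * by lra. fold m in hq, hm |- *.
  assert (hK := K_pos m ltac:(lra)).
  assert (hL := legendre_relation m ltac:(lra)).
  unfold legendre_form in hL.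
  rewrite <- hq.
  replace (E (1 - m)) with
    ((PI / 2 - E m * K (1 - m) + K m * K (1 - m)) / K m)
    by (rewrite <- hL; field; lra).
  field. lra.
Qed.

(** * The hypergeometric series and its equation *)

Definition cubic_coeff (n : nat) : R :=
  pochhammer (1 / 3) n * pochhammer (1 / 2) n * pochhammer (2 / 3) n
    / pochhammer 1 n ^ 3.

(** The Euler operator z d/dz on coefficients. *)
Definition theta (a : nat -> R) (n : nat) : R := INR n * a n.

Lemma theta_PS_derive a n : theta a n = PS_incr_1 (PS_derive a) n.
Proof.
  unfold theta. destruct n as [|n]; simpl PS_incr_1.
  - simpl. apply Rmult_0_l.
  - reflexivity.
Qed.

Lemma CV_radius_theta a : CV_radius (theta a) = CV_radius a.
Proof.
  rewrite (CV_radius_ext _ _ (theta_PS_derive a)).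
  rewrite CV_radius_incr_1. apply CV_radius_derive.
Qed.

Lemma PSeries_theta a x : PSeries (theta a) x = x * PSeries (PS_derive a) x.
Proof.
  rewrite (PSeries_ext _ _ x (theta_PS_derive a)).
  apply PSeries_incr_1.
Qed.

Lemma is_derive_PSeries_theta a x :
  x <> 0 -> Rbar_lt (Rabs x) (CV_radius a) ->
  is_derive (PSeries a) x (PSeries (theta a) x / x).
Proof.
  intros hx ha. rewrite PSeries_theta.
  replace (x * PSeries (PS_derive a) x / x) with (PSeries (PS_derive a) x)
    by (field; exact hx).
  apply is_derive_PSeries, ha.
Qed.

Lemma PSeries_theta_0 a : PSeries (theta a) 0 = 0.
Proof. rewrite PSeries_theta. apply Rmult_0_l. Qed.

Lemma pochhammer_pos u n : 0 < u -> 0 < pochhammer u n.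
Proof.
  intros hu. induction n as [|n IH]; simpl; [lra|].
  apply Rmult_lt_0_compat; [exact IH|]. pose proof (pos_INR n). lra.
Qed.

Lemma pochhammer_le_1 u n : 0 < u <= 1 -> pochhammer u n <= pochhammer 1 n.
Proof.
  intros hu. induction n as [|n IH]; simpl; [lra|].
  pose proof (pos_INR n). pose proof (pochhammer_pos u n).
  apply Rmult_le_compat; lra.
Qed.

Lemma cubic_coeff_bounds n : 0 <= cubic_coeff n <= 1.
Proof.
  assert (hp := pochhammer_pos 1 n Rlt_0_1).
  assert (hp1 := pochhammer_pos (1 / 3) n ltac:(lra)).
  assert (hp2 := pochhammer_pos (1 / 2) n ltac:(lra)).
  assert (hp3 := pochhammer_pos (2 / 3) n ltac:(lra)).
  assert (hl1 := pochhammer_le_1 (1 / 3) n ltac:(lra)).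
  assert (hl2 := pochhammer_le_1 (1 / 2) n ltac:(lra)).
  assert (hl3 := pochhammer_le_1 (2 / 3) n ltac:(lra)).
  assert (hp' : 0 < pochhammer 1 n ^ 3) by (apply pow_lt, hp).
  unfold cubic_coeff. split.
  - apply Rlt_le, Rdiv_lt_0_compat; [|exact hp'].
    repeat apply Rmult_lt_0_compat; assumption.
  - apply Rle_div_l; [exact hp'|]. rewrite Rmult_1_l.
    replace (pochhammer 1 n ^ 3) with
      (pochhammer 1 n * pochhammer 1 n * pochhammer 1 n) by ring.
    repeat apply Rmult_le_compat; try lra.
    apply Rlt_le, Rmult_lt_0_compat; assumption.
Qed.

Lemma CV_radius_cubic_coeff : Rbar_le 1 (CV_radius cubic_coeff).
Proof.
  destruct (CV_radius_bounded cubic_coeff) as [h _]. apply h.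
  exists 1. intros n. rewrite pow1, Rmult_1_r.
  destruct (cubic_coeff_bounds n). rewrite Rabs_pos_eq; assumption.
Qed.

Lemma cubic_coeff_S n :
  INR (S n) ^ 3 * cubic_coeff (S n)
  = (INR n ^ 3 + 3 / 2 * INR n ^ 2 + 13 / 18 * INR n + 1 / 9) * cubic_coeff n.
Proof.
  assert (hp := pochhammer_pos 1 n Rlt_0_1).
  pose proof (pos_INR n).
  unfold cubic_coeff. simpl pochhammer. rewrite S_INR.
  field. split; lra.
Qed.

Lemma Rabs_lt_CV_radius z a :
  Rabs z < 1 -> Rbar_le 1 (CV_radius a) -> Rbar_lt (Rabs z) (CV_radius a).
Proof. intros hz ha. apply Rbar_lt_le_trans with 1; assumption. Qed.

(** The recurrence [cubic_coeff_S] in the form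
    theta^3 = z (theta + 1/3) (theta + 1/2) (theta + 2/3). *)
Lemma cubic_series_ode z :
  Rabs z < 1 ->
  PSeries (theta (theta (theta cubic_coeff))) z
  = z * (PSeries (theta (theta (theta cubic_coeff))) z
         + 3 / 2 * PSeries (theta (theta cubic_coeff)) z
         + 13 / 18 * PSeries (theta cubic_coeff) z
         + 1 / 9 * PSeries cubic_coeff z).
Proof.
  intros hz.
  assert (hc := Rabs_lt_CV_radius z _ hz CV_radius_cubic_coeff).
  assert (h0 : ex_pseries cubic_coeff z) by (apply CV_radius_inside; exact hc).
  assert (h1 : ex_pseries (theta cubic_coeff) z)
    by (apply CV_radius_inside; rewrite !CV_radius_theta; exact hc).
  assert (h2 : ex_pseries (theta (theta cubic_coeff)) z)
    by (apply CV_radius_inside; rewrite !CV_radius_theta; exact hc).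
  assert (h3 : ex_pseries (theta (theta (theta cubic_coeff))) z)
    by (apply CV_radius_inside; rewrite !CV_radius_theta; exact hc).
  assert (hs : forall (c : R) (a : nat -> R),
    ex_pseries a z -> ex_pseries (PS_scal c a) z).
  { intros c a. apply ex_pseries_scal, Rmult_comm. }
  rewrite <- !PSeries_scal.
  rewrite <- !PSeries_plus; repeat (apply ex_pseries_plus); auto.
  rewrite <- PSeries_incr_1. apply PSeries_ext. intros [|n].
  - unfold theta. simpl. apply Rmult_0_l.
  - unfold PS_incr_1, PS_plus, PS_scal, plus, scal; simpl; unfold mult; simpl.
    generalize (cubic_coeff_S n). unfold theta. intros H.
    replace (INR (S n) * (INR (S n) * (INR (S n) * cubic_coeff (S n))))
      with (INR (S n) ^ 3 * cubic_coeff (S n)) by ring.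
    rewrite H. ring.
Qed.

Lemma is_series_cubic (a b z : R) :
  Rabs z < 1 ->
  is_series (fun n => cubic_coeff n * z ^ n * (a + b * INR n))
    (a * PSeries cubic_coeff z + b * PSeries (theta cubic_coeff) z).
Proof.
  intros hz.
  assert (hc := Rabs_lt_CV_radius z _ hz CV_radius_cubic_coeff).
  assert (h0 := PSeries_correct _ _ (CV_radius_inside _ _ hc)).
  rewrite <- CV_radius_theta in hc.
  assert (h1 := PSeries_correct _ _ (CV_radius_inside _ _ hc)).
  eapply is_series_ext;
    [|exact (is_series_plus _ _ _ _ (is_series_scal a _ _ h0)
                                    (is_series_scal b _ _ h1))].
  intros n. unfold theta, plus, scal; simpl; unfold mult; simpl.
  rewrite pow_n_pow. ring.
Qed.

(** * Uniqueness for a symmetric square at a singular point *)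

Lemma zero_derivative_constant (f : R -> R) b :
  continuous f 0 -> (forall x, 0 < x <= b -> is_derive f x 0) ->
  forall x, 0 < x <= b -> f x = f 0.
Proof.
  intros hc hd x hx.
  destruct (MVT_gen f 0 x (fun _ => 0)) as [c [_ h]].
  - intros t ht. rewrite Rmin_left, Rmax_right in ht by lra. apply hd. lra.
  - intros t ht. rewrite Rmin_left, Rmax_right in ht by lra.
    apply continuity_pt_filterlim.
    destruct (Req_dec t 0) as [->|ht0]; [exact hc|].
    apply (ex_derive_continuous f). exists 0. apply hd. lra.
  - lra.
Qed.

(** Let delta be the derivation (1 / rho) d/dx.  The hypotheses say that
    delta^2 g = q g, with q1 = delta q, and that w, with w1 = delta w and
    w2 = delta^2 w, satisfies delta^3 w = 4 q delta w + 2 (delta q) w, the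
    equation of the products of two solutions of the former.  At 0 the function
    rho may have a pole, so that w and g need only be continuous there.

    The method is a change of gauge.  Let v = w / g^2 and D = g^2 delta.  The
    equation for w becomes D^3 v = 0, so D^2 v, D v and v are constant in turn,
    and their values are read off at 0. *)
Section SymmetricSquare.

Variables (b : R) (rho q q1 w w1 w2 g g1 : R -> R).

Hypothesis q_deriv : forall x, 0 < x <= b -> is_derive q x (rho x * q1 x).
Hypothesis w_deriv : forall x, 0 < x <= b -> is_derive w x (rho x * w1 x).
Hypothesis w1_deriv : forall x, 0 < x <= b -> is_derive w1 x (rho x * w2 x).
Hypothesis w2_deriv : forall x, 0 < x <= b ->
  is_derive w2 x (rho x * (4 * q x * w1 x + 2 * q1 x * w x)).
Hypothesis g_deriv : forall x, 0 < x <= b -> is_derive g x (rho x * g1 x).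
Hypothesis g1_deriv : forall x, 0 < x <= b ->
  is_derive g1 x (rho x * (q x * g x)).
Hypothesis g_nonzero : forall x, 0 <= x <= b -> g x <> 0.

(** This is D^2 v. *)
Let eliminant x :=
  g x ^ 2 * w2 x - 2 * g x * g1 x * w1 x - 2 * q x * w x * g x ^ 2
  + 2 * w x * g1 x ^ 2.

Lemma is_derive_eliminant x : 0 < x <= b -> is_derive eliminant x 0.
Proof.
  intros hx.
  assert (hq := q_deriv x hx). assert (hw := w_deriv x hx).
  assert (hw1 := w1_deriv x hx). assert (hw2 := w2_deriv x hx).
  assert (hg := g_deriv x hx). assert (hg1 := g1_deriv x hx).
  unfold eliminant. auto_derive.
  - repeat split; eexists; eassumption.
  - change (fun x => g x) with g. change (fun x => w x) with w.
    change (fun x => w1 x) with w1. change (fun x => w2 x) with w2.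
    change (fun x => g1 x) with g1. change (fun x => q x) with q.
    rewrite (is_derive_unique _ _ _ hq), (is_derive_unique _ _ _ hw),
      (is_derive_unique _ _ _ hw1), (is_derive_unique _ _ _ hw2),
      (is_derive_unique _ _ _ hg), (is_derive_unique _ _ _ hg1).
    ring.
Qed.

(** This is D v. *)
Let log_wronskian x := w1 x - 2 * w x * g1 x / g x.

Lemma is_derive_log_wronskian x :
  0 < x <= b ->
  is_derive log_wronskian x (rho x * eliminant x / g x ^ 2).
Proof.
  intros hx. assert (hg0 := g_nonzero x ltac:(lra)).
  assert (hw := w_deriv x hx). assert (hw1 := w1_deriv x hx).
  assert (hg := g_deriv x hx). assert (hg1 := g1_deriv x hx).
  unfold log_wronskian. auto_derive.
  - repeat split; try (eexists; eassumption). exact hg0.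
  - change (fun x => g x) with g. change (fun x => w x) with w.
    change (fun x => w1 x) with w1. change (fun x => g1 x) with g1.
    rewrite (is_derive_unique _ _ _ hw), (is_derive_unique _ _ _ hw1),
      (is_derive_unique _ _ _ hg), (is_derive_unique _ _ _ hg1).
    unfold eliminant. field. exact hg0.
Qed.

Lemma is_derive_quotient x :
  0 < x <= b ->
  is_derive (fun x => w x / g x ^ 2) x (rho x * log_wronskian x / g x ^ 2).
Proof.
  intros hx. assert (hg0 := g_nonzero x ltac:(lra)).
  assert (hw := w_deriv x hx). assert (hg := g_deriv x hx).
  auto_derive.
  - repeat split; try (eexists; eassumption). rewrite Rmult_1_r.
    apply Rmult_integral_contrapositive_currified; exact hg0.
  - change (fun x => g x) with g. change (fun x => w x) with w.
    rewrite (is_derive_unique _ _ _ hw), (is_derive_unique _ _ _ hg).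
    unfold log_wronskian. field. exact hg0.
Qed.

Hypothesis q_cont : continuous q 0.
Hypothesis w_cont : continuous w 0.
Hypothesis w1_cont : continuous w1 0.
Hypothesis w2_cont : continuous w2 0.
Hypothesis g_cont : continuous g 0.
Hypothesis g1_cont : continuous g1 0.
Hypothesis b_pos : 0 < b.
Hypothesis q_0 : q 0 = 0.
Hypothesis w_0 : w 0 = g 0 ^ 2.
Hypothesis w1_0 : w1 0 = 0.
Hypothesis w2_0 : w2 0 = 0.
Hypothesis g1_0 : g1 0 = 0.

Lemma symmetric_square_unique x :
  0 < x <= b -> w x = g x ^ 2 /\ w1 x = 2 * g x * g1 x.
Proof.
  intros hx.
  assert (hg0 := g_nonzero 0 ltac:(lra)).
  assert (cont := fun f => proj2 (continuity_pt_filterlim f 0)).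
  assert (cq := cont _ q_cont). assert (cw := cont _ w_cont).
  assert (cw1 := cont _ w1_cont). assert (cw2 := cont _ w2_cont).
  assert (cg := cont _ g_cont). assert (cg1 := cont _ g1_cont).
  assert (cgg : continuity_pt (fun x => g x ^ 2) 0).
  { apply (continuity_pt_ext (fun x => g x * g x)); [intros t; ring|].
    exact (continuity_pt_mult _ _ _ cg cg). }
  assert (hM : forall t, 0 < t <= b -> eliminant t = 0).
  { intros t ht.
    rewrite (zero_derivative_constant eliminant b); trivial.
    - unfold eliminant. rewrite q_0, w1_0, w2_0, g1_0. ring.
    - apply continuity_pt_filterlim.
      apply (continuity_pt_ext (fun x => g x * g x * w2 x
        + (-2) * (g x * g1 x * w1 x) + (-2) * (q x * w x * (g x * g x))
        + 2 * (w x * (g1 x * g1 x)))); [intros s; unfold eliminant; ring|].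
      repeat apply (continuity_pt_plus (fun x => _) (fun x => _));
        repeat (apply (continuity_pt_mult (fun x => _) (fun x => _)));
        trivial; apply continuity_pt_const; intros ? ?; reflexivity.
    - exact is_derive_eliminant. }
  assert (hN : forall t, 0 < t <= b -> log_wronskian t = 0).
  { intros t ht.
    rewrite (zero_derivative_constant log_wronskian b); trivial.
    - unfold log_wronskian. rewrite w1_0, g1_0. field. exact hg0.
    - apply continuity_pt_filterlim.
      apply (continuity_pt_minus w1 (fun x => _)); trivial.
      apply (continuity_pt_div (fun x => _) g); trivial.
      repeat (apply (continuity_pt_mult (fun x => _) (fun x => _)));
        trivial; apply continuity_pt_const; intros ? ?; reflexivity.
    - intros s hs. replace 0 with (rho s * eliminant s / g s ^ 2).
      + apply is_derive_log_wronskian, hs.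
      + rewrite hM by exact hs. unfold Rdiv. ring. }
  assert (hv : w x / g x ^ 2 = 1).
  { rewrite (zero_derivative_constant (fun x => w x / g x ^ 2) b); trivial.
    - rewrite w_0. field. exact hg0.
    - apply continuity_pt_filterlim.
      apply (continuity_pt_div w (fun x => g x ^ 2)); trivial.
      apply pow_nonzero, hg0.
    - intros s hs. replace 0 with (rho s * log_wronskian s / g s ^ 2).
      + apply is_derive_quotient, hs.
      + rewrite hN by exact hs. unfold Rdiv. ring. }
  assert (hgx := g_nonzero x ltac:(lra)).
  assert (hw : w x = g x ^ 2).
  { replace (w x) with (w x / g x ^ 2 * g x ^ 2) by (field; exact hgx).
    rewrite hv. ring. }
  split; [exact hw|].
  assert (h := hN x hx). unfold log_wronskian in h. rewrite hw in h.
  replace (w1 x) with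
    (w1 x - 2 * g x ^ 2 * g1 x / g x + 2 * g x * g1 x) by (field; exact hgx).
  rewrite h. ring.
Qed.

End SymmetricSquare.

(** * The cubic transformation *)

Definition modulus_sqr (p : R) : R := p ^ 3 * (2 + p) / (1 + 2 * p).

(** With the nome q of the modulus, cubic_arg p is the cubic modulus
    c^3 / a^3 of Borwein and Borwein at - q^(1/3). *)
Definition cubic_arg (p : R) : R :=
  - (27 * (p * (1 + p))) / (2 * (1 - 2 * (p * (1 + p))) ^ 3).

(** The logarithmic derivative that links p with delta = y (1 - y) d/dy, namely
    (dy/dp) / (y (1 - y)); see [is_derive_cubic_arg]. *)
Definition log_speed (p : R) : R :=
  2 * (1 - 2 * (p * (1 + p))) ^ 2
  / (p * (1 + p) * ((1 - p) * (2 + p)) * (1 + 2 * p)).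

(** The algebraic factor is the one that turns the differential equation of K
    into the hypergeometric equation with parameters 1/3, 2/3; 1 in
    [cubic_arg]. *)
Definition cubic_solution (p : R) : R :=
  (1 - 2 * (p * (1 + p))) / sqrt (1 + 2 * p) * (2 / PI * K (modulus_sqr p)).

(** This is delta applied to [cubic_solution], in closed form: it stays regular
    at p = 0 although [log_speed] has a pole there. *)
Definition cubic_solution1 (p : R) : R :=
  3 / PI * (1 + 2 * p) / ((1 - 2 * (p * (1 + p))) ^ 2 * sqrt (1 + 2 * p))
  * ((1 - 2 * (p * (1 + p))) * E (modulus_sqr p)
     - (1 - p ^ 2) * K (modulus_sqr p)).

Lemma one_minus_modulus_sqr p :
  1 + 2 * p <> 0 ->
  1 - modulus_sqr p = (1 - p) * (1 + p) ^ 3 / (1 + 2 * p).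
Proof. intros hp. unfold modulus_sqr. field. exact hp. Qed.

Lemma modulus_sqr_bounds p :
  0 < p < 1 / 4 -> 0 < modulus_sqr p < 1 / 2.
Proof.
  intros hp. unfold modulus_sqr. split.
  - apply Rdiv_lt_0_compat; [|lra]. apply Rmult_lt_0_compat; [|lra].
    apply pow_lt; lra.
  - apply Rlt_div_l; [lra|]. nra.
Qed.

Lemma is_derive_modulus_sqr p :
  0 < p < 1 / 4 ->
  is_derive modulus_sqr p (6 * p ^ 2 * (1 + p) ^ 2 / (1 + 2 * p) ^ 2).
Proof.
  intros hp. unfold modulus_sqr. auto_derive; [lra|]. field. lra.
Qed.

Lemma is_derive_cubic_arg p :
  0 < p < 1 / 4 ->
  is_derive cubic_arg p
    (log_speed p * (cubic_arg p * (1 - cubic_arg p))).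
Proof.
  intros hp. assert (hu : 1 - 2 * (p * (1 + p)) <> 0) by nra.
  assert (p * (1 + p) <> 0) by nra.
  unfold cubic_arg, log_speed. auto_derive.
  - repeat apply Rmult_integral_contrapositive_currified; lra.
  - field. repeat split; lra.
Qed.

Lemma is_derive_cubic_solution p :
  0 < p < 1 / 4 ->
  is_derive cubic_solution p (log_speed p * cubic_solution1 p).
Proof.
  intros hp. assert (hu : 1 - 2 * (p * (1 + p)) <> 0) by nra.
  assert (hm := modulus_sqr_bounds p hp).
  assert (hdm := is_derive_modulus_sqr p hp).
  assert (hK := is_derive_K (modulus_sqr p) ltac:(lra) ltac:(lra)).
  assert (hs : 0 < sqrt (1 + 2 * p)) by (apply sqrt_lt_R0; lra).
  assert (hss : sqrt (1 + 2 * p) * sqrt (1 + 2 * p) = 1 + 2 * p)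
    by (apply sqrt_sqrt; lra).
  pose proof PI_RGT_0.
  unfold cubic_solution, cubic_solution1. auto_derive.
  - repeat split; try lra; eexists; eassumption.
  - change (fun x => K x) with K.
    change (fun x => modulus_sqr x) with modulus_sqr.
    rewrite (is_derive_unique _ _ _ hK), (is_derive_unique _ _ _ hdm).
    rewrite one_minus_modulus_sqr by lra.
    set (k := K (modulus_sqr p)). set (e := E (modulus_sqr p)).
    set (s := sqrt (1 + 2 * p)) in *.
    unfold log_speed, modulus_sqr.
    (* Only even powers of the square root s remain. *)
    field_simplify_eq; [|repeat split; try nra].
    replace (s ^ 2) with (1 + 2 * p) by (rewrite <- hss; ring).
    ring.
Qed.

(** The second-order equation of [cubic_solution]: delta^2 g = (2/9) y (1 - y) g. *)
Lemma is_derive_cubic_solution1 p :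
  0 < p < 1 / 4 ->
  is_derive cubic_solution1 p
    (log_speed p
     * (4 * cubic_arg p * (1 - cubic_arg p) / 18 * cubic_solution p)).
Proof.
  intros hp. assert (hu : 1 - 2 * (p * (1 + p)) <> 0) by nra.
  assert (hm := modulus_sqr_bounds p hp).
  assert (hdm := is_derive_modulus_sqr p hp).
  assert (hK := is_derive_K (modulus_sqr p) ltac:(lra) ltac:(lra)).
  assert (hE := is_derive_E (modulus_sqr p) ltac:(lra) ltac:(lra)).
  assert (hs : 0 < sqrt (1 + 2 * p)) by (apply sqrt_lt_R0; lra).
  assert (hss : sqrt (1 + 2 * p) * sqrt (1 + 2 * p) = 1 + 2 * p)
    by (apply sqrt_sqrt; lra).
  pose proof PI_RGT_0.
  unfold cubic_solution, cubic_solution1. auto_derive.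
  - repeat split; try lra; try (eexists; eassumption).
    rewrite Rmult_1_r.
    repeat apply Rmult_integral_contrapositive_currified; try lra.
  - change (fun x => K x) with K. change (fun x => E x) with E.
    change (fun x => modulus_sqr x) with modulus_sqr.
    rewrite (is_derive_unique _ _ _ hK), (is_derive_unique _ _ _ hE),
      (is_derive_unique _ _ _ hdm).
    rewrite one_minus_modulus_sqr by lra.
    set (k := K (modulus_sqr p)). set (e := E (modulus_sqr p)).
    set (s := sqrt (1 + 2 * p)) in *.
    unfold log_speed, cubic_arg, modulus_sqr.
    field_simplify_eq; [|repeat split; try nra].
    replace (s ^ 2) with (1 + 2 * p) by (rewrite <- hss; ring).
    ring.
Qed.

Lemma cubic_arg_neg p : 0 < p < 1 / 4 -> cubic_arg p < 0.
Proof.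
  intros hp. unfold cubic_arg, Rdiv.
  apply Rmult_neg_pos; [nra|].
  apply Rinv_0_lt_compat, Rmult_lt_0_compat; [lra|]. apply pow_lt. nra.
Qed.

Lemma cubic_arg_decreasing p p' :
  0 < p' <= p -> p < 1 / 4 -> cubic_arg p <= cubic_arg p'.
Proof.
  intros hp hp1. unfold cubic_arg.
  assert (hu : 0 < 1 - 2 * (p * (1 + p))) by nra.
  assert (hu' : 1 - 2 * (p * (1 + p)) <= 1 - 2 * (p' * (1 + p'))) by nra.
  assert (h3 : (1 - 2 * (p * (1 + p))) ^ 3 <= (1 - 2 * (p' * (1 + p'))) ^ 3)
    by (apply pow_incr; lra).
  assert (h0 : 0 < (1 - 2 * (p * (1 + p))) ^ 3) by (apply pow_lt, hu).
  unfold Rdiv. rewrite !Ropp_mult_distr_l_reverse. apply Ropp_le_contravar.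
  apply Rmult_le_compat; try nra.
  - apply Rlt_le, Rinv_0_lt_compat. lra.
  - apply Rinv_le_contravar; lra.
Qed.

Lemma ex_derive_cubic_solution_0 : ex_derive cubic_solution 0.
Proof.
  pose proof PI_RGT_0.
  assert (hm : modulus_sqr 0 = 0) by (unfold modulus_sqr; field).
  unfold cubic_solution. auto_derive. repeat split; try lra.
  - apply Rgt_not_eq, sqrt_lt_R0. lra.
  - rewrite hm. apply ex_derive_K. lra.
  - unfold modulus_sqr. auto_derive. lra.
Qed.

Lemma ex_derive_cubic_solution1_0 : ex_derive cubic_solution1 0.
Proof.
  pose proof PI_RGT_0.
  assert (hm : modulus_sqr 0 = 0) by (unfold modulus_sqr; field).
  assert (hdm : ex_derive modulus_sqr 0)
    by (unfold modulus_sqr; auto_derive; lra).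
  unfold cubic_solution1. auto_derive. repeat split; try lra; trivial.
  - assert (hs : 0 < sqrt (1 + 2 * 0)) by (apply sqrt_lt_R0; lra).
    apply Rgt_not_eq. rewrite Rmult_1_r.
    repeat apply Rmult_lt_0_compat; try lra; exact hs.
  - rewrite hm. apply ex_derive_E. lra.
  - rewrite hm. apply ex_derive_K. lra.
Qed.

Lemma cubic_solution_pos p : 0 <= p < 1 / 4 -> 0 < cubic_solution p.
Proof.
  intros hp. pose proof PI_RGT_0. unfold cubic_solution.
  assert (hm : 0 <= modulus_sqr p < 1).
  { destruct (Req_dec p 0) as [->|h0].
    - unfold modulus_sqr. lra.
    - assert (h := modulus_sqr_bounds p ltac:(lra)). lra. }
  repeat apply Rmult_lt_0_compat.
  - nra.
  - apply Rinv_0_lt_compat, sqrt_lt_R0. lra.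
  - lra.
  - apply Rinv_0_lt_compat. lra.
  - apply K_pos, hm.
Qed.

Lemma cubic_solution_0 : cubic_solution 0 = 1.
Proof.
  pose proof PI_RGT_0. unfold cubic_solution.
  replace (modulus_sqr 0) with 0 by (unfold modulus_sqr; field).
  rewrite K_0, Rmult_0_r, Rplus_0_r, sqrt_1. field. lra.
Qed.

Lemma cubic_solution1_0 : cubic_solution1 0 = 0.
Proof.
  unfold cubic_solution1.
  replace (modulus_sqr 0) with 0 by (unfold modulus_sqr; field).
  rewrite K_0, E_0. ring.
Qed.

Definition series_arg (p : R) : R := 4 * cubic_arg p * (1 - cubic_arg p).

Definition pullback (a : nat -> R) (p : R) : R := PSeries a (series_arg p).

Section Transformation.

Variable b : R.
Hypothesis b_range : 0 < b < 1 / 4.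
Hypothesis b_conv : Rabs (series_arg b) < 1.

Lemma series_arg_bounds p :
  0 < p <= b -> -1 < series_arg p < 0.
Proof.
  intros hp.
  assert (h1 := cubic_arg_neg p ltac:(lra)).
  assert (h2 := cubic_arg_decreasing b p ltac:(lra) ltac:(lra)).
  apply Rabs_def2 in b_conv. unfold series_arg in *. split; nra.
Qed.

Lemma is_derive_series_arg p :
  0 < p <= b ->
  is_derive series_arg p
    (log_speed p * ((1 - 2 * cubic_arg p) * series_arg p)).
Proof.
  intros hp. assert (hy := is_derive_cubic_arg p ltac:(lra)).
  unfold series_arg. auto_derive.
  - split; [eexists; exact hy|]. split; [eexists; exact hy|easy].
  - change (fun x => cubic_arg x) with cubic_arg.
    rewrite (is_derive_unique _ _ _ hy). ring.
Qed.

Lemma is_derive_pullback a p :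
  Rbar_le 1 (CV_radius a) -> 0 < p <= b ->
  is_derive (pullback a) p (log_speed p * ((1 - 2 * cubic_arg p) * pullback (theta a) p)).
Proof.
  intros ha hp. assert (hz := series_arg_bounds p hp).
  unfold pullback.
  replace (log_speed p * ((1 - 2 * cubic_arg p)
             * PSeries (theta a) (series_arg p)))
    with (scal (log_speed p * ((1 - 2 * cubic_arg p) * series_arg p))
            (PSeries (theta a) (series_arg p)
             / series_arg p)).
  2:{ unfold scal; simpl; unfold mult; simpl. field. lra. }
  apply (is_derive_comp (PSeries a) series_arg).
  - apply is_derive_PSeries_theta; [lra|].
    apply Rabs_lt_CV_radius; [apply Rabs_def1; lra|exact ha].
  - apply is_derive_series_arg, hp.
Qed.

Lemma ex_derive_pullback_0 a :
  Rbar_le 1 (CV_radius a) -> ex_derive (pullback a) 0.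
Proof.
  intros ha.
  apply (ex_derive_comp (PSeries a) series_arg).
  - eexists. apply is_derive_PSeries.
    replace (series_arg 0) with 0 by (unfold series_arg, cubic_arg; field).
    rewrite Rabs_R0. apply Rbar_lt_le_trans with 1; [simpl; lra|exact ha].
  - unfold series_arg, cubic_arg. auto_derive. lra.
Qed.

(** Uniqueness applies because z = 4 y (1 - y) satisfies
    delta z = (1 - 2 y) z, so that delta acts on functions of z as (1 - 2 y)
    times the Euler operator.  As (1 - 2 y)^2 = 1 - z, the third-order equation
    of the series becomes the symmetric square with q = z / 18. *)
Lemma cubic_transformation :
  pullback cubic_coeff b = cubic_solution b ^ 2
  /\ (1 - 2 * cubic_arg b) * pullback (theta cubic_coeff) b
     = 2 * cubic_solution b * cubic_solution1 b.
Proof.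
  pose proof CV_radius_cubic_coeff as R0.
  assert (R1 : Rbar_le 1 (CV_radius (theta cubic_coeff)))
    by (rewrite CV_radius_theta; exact R0).
  assert (R2 : Rbar_le 1 (CV_radius (theta (theta cubic_coeff))))
    by (rewrite CV_radius_theta; exact R1).
  assert (hy0 : cubic_arg 0 = 0) by (unfold cubic_arg; field).
  assert (hz0 : series_arg 0 = 0) by (unfold series_arg; rewrite hy0; ring).
  assert (dy0 : ex_derive cubic_arg 0) by (unfold cubic_arg; auto_derive; lra).
  assert (dz0 : ex_derive series_arg 0)
    by (unfold series_arg; auto_derive; repeat split; exact dy0).
  assert (d0 := fun p => is_derive_pullback cubic_coeff p R0).
  assert (d1 := fun p => is_derive_pullback (theta cubic_coeff) p R1).
  assert (d2 := fun p => is_derive_pullback (theta (theta cubic_coeff)) p R2).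
  assert (c0 := ex_derive_pullback_0 cubic_coeff R0).
  assert (c1 := ex_derive_pullback_0 (theta cubic_coeff) R1).
  assert (c2 := ex_derive_pullback_0 (theta (theta cubic_coeff)) R2).
  assert (hode : forall p, 0 < p <= b ->
    (1 - series_arg p) * pullback (theta (theta (theta cubic_coeff))) p
    = series_arg p * (3 / 2 * pullback (theta (theta cubic_coeff)) p
        + 13 / 18 * pullback (theta cubic_coeff) p
        + 1 / 9 * pullback cubic_coeff p)).
  { intros p hp. assert (hz := series_arg_bounds p hp).
    assert (h := cubic_series_ode (series_arg p) ltac:(apply Rabs_def1; lra)).
    unfold pullback. lra. }
  assert (v0 : pullback cubic_coeff 0 = 1).
  { unfold pullback. rewrite hz0, PSeries_0.
    unfold cubic_coeff. simpl. field. }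
  assert (v1 : pullback (theta cubic_coeff) 0 = 0).
  { unfold pullback. rewrite hz0. apply PSeries_theta_0. }
  assert (v2 : pullback (theta (theta cubic_coeff)) 0 = 0).
  { unfold pullback. rewrite hz0. apply PSeries_theta_0. }
  set (f0 := pullback cubic_coeff) in *.
  set (f1 := pullback (theta cubic_coeff)) in *.
  set (f2 := pullback (theta (theta cubic_coeff))) in *.
  set (f3 := pullback (theta (theta (theta cubic_coeff)))) in *.
  clearbody f0 f1 f2 f3.
  apply (symmetric_square_unique b log_speed (fun p => series_arg p / 18)
    (fun p => (1 - 2 * cubic_arg p) * series_arg p / 18)
    f0
    (fun p => (1 - 2 * cubic_arg p) * f1 p)
    (fun p => (1 - series_arg p) * f2 p - series_arg p / 2 * f1 p)
    cubic_solution cubic_solution1); try lra.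
  - intros p hp. assert (hz := is_derive_series_arg p hp).
    auto_derive; [eexists; exact hz|].
    change (fun x => series_arg x) with series_arg.
    rewrite (is_derive_unique _ _ _ hz). field.
  - intros p hp. apply d0, hp.
  - intros p hp. assert (hy := is_derive_cubic_arg p ltac:(lra)).
    assert (h := d1 p hp).
    auto_derive; [repeat split; eexists; eassumption|].
    change (fun x => cubic_arg x) with cubic_arg.
    change (fun x => f1 x) with f1.
    rewrite (is_derive_unique _ _ _ hy), (is_derive_unique _ _ _ h).
    unfold series_arg. field.
  - intros p hp. assert (hz := is_derive_series_arg p hp).
    assert (h1 := d1 p hp). assert (h2 := d2 p hp).
    assert (hzb := series_arg_bounds p hp).
    auto_derive; [repeat split; eexists; eassumption|].
    change (fun x => series_arg x) with series_arg.
    change (fun x => f1 x) with f1. change (fun x => f2 x) with f2.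
    rewrite (is_derive_unique _ _ _ hz), (is_derive_unique _ _ _ h1),
      (is_derive_unique _ _ _ h2).
    replace (f3 p) with (series_arg p * (3 / 2 * f2 p + 13 / 18 * f1 p
                           + 1 / 9 * f0 p) / (1 - series_arg p)).
    2:{ rewrite <- hode by exact hp. field. lra. }
    field. lra.
  - intros p hp. apply is_derive_cubic_solution. lra.
  - intros p hp. apply is_derive_cubic_solution1. lra.
  - intros p hp. apply Rgt_not_eq, cubic_solution_pos. lra.
  - apply (ex_derive_continuous (fun p => series_arg p / 18)).
    auto_derive. exact dz0.
  - apply (ex_derive_continuous f0), c0.
  - apply (ex_derive_continuous (fun p => (1 - 2 * cubic_arg p) * f1 p)).
    auto_derive. repeat split; assumption.
  - apply (ex_derive_continuous
      (fun p => (1 - series_arg p) * f2 p - series_arg p / 2 * f1 p)).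
    auto_derive. repeat split; assumption.
  - apply (ex_derive_continuous cubic_solution), ex_derive_cubic_solution_0.
  - apply (ex_derive_continuous cubic_solution1), ex_derive_cubic_solution1_0.
  - rewrite v0, cubic_solution_0. ring.
  - rewrite v1. ring.
  - rewrite v1, v2. field.
  - exact cubic_solution1_0.
Qed.

End Transformation.

(** * The series for 1 / PI *)

(** The left-hand side is negative for negative y.  The case 4 x = 1 is excluded
    as well, since then the right-hand side is a division by zero, hence 0. *)
Lemma one_minus_4x_pos x y :
  - (1 / 2) < y < 0 -> 0 < x ->
  64 * (y - 1) * y ^ 3 / (8 * y - 9) ^ 3 = - (27 * x / (1 - 4 * x) ^ 3) ->
  0 < 1 - 4 * x.
Proof.
  intros hy hx h.
  assert (hL : 64 * (y - 1) * y ^ 3 / (8 * y - 9) ^ 3 < 0).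
  { replace (64 * (y - 1) * y ^ 3 / (8 * y - 9) ^ 3)
      with (- (64 * (1 - y) * (- y) ^ 3 * / (9 - 8 * y) ^ 3))
      by (field; repeat split; lra).
    apply Ropp_lt_gt_0_contravar, Rmult_lt_0_compat.
    - assert (0 < (- y) ^ 3) by (apply pow_lt; lra). nra.
    - apply Rinv_0_lt_compat, pow_lt. lra. }
  destruct (Rlt_le_dec 0 (1 - 4 * x)) as [hp|hn]; [exact hp|exfalso].
  rewrite h in hL.
  destruct (Req_dec (1 - 4 * x) 0) as [h0|h0].
  - rewrite h0 in hL. unfold Rdiv in hL.
    replace (0 ^ 3) with 0 in hL by ring. rewrite Rinv_0 in hL. lra.
  - assert (0 < 27 * x / (4 * x - 1) ^ 3).
    { apply Rdiv_lt_0_compat; [lra|]. apply pow_lt. lra. }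
    replace (27 * x / (1 - 4 * x) ^ 3) with (- (27 * x / (4 * x - 1) ^ 3)) in hL
      by (field; split; lra).
    lra.
Qed.

Lemma cubic_invariant_injective x x' :
  0 < x -> 0 < x' -> 0 < 1 - 4 * x -> 0 < 1 - 4 * x' ->
  27 * x / (1 - 4 * x) ^ 3 = 27 * x' / (1 - 4 * x') ^ 3 -> x = x'.
Proof.
  assert (H : forall x x', 0 < x < x' -> 0 < 1 - 4 * x' ->
     27 * x / (1 - 4 * x) ^ 3 < 27 * x' / (1 - 4 * x') ^ 3).
  { intros s t hst ht. unfold Rdiv.
    apply Rlt_le_trans with (27 * t * / (1 - 4 * s) ^ 3).
    - apply Rmult_lt_compat_r; [|lra].
      apply Rinv_0_lt_compat, pow_lt. lra.
    - apply Rmult_le_compat_l; [lra|]. apply Rinv_le_contravar.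
      + apply pow_lt, ht.
      + apply pow_incr. lra. }
  intros hx hx' h4 h4' h.
  destruct (Rtotal_order x x') as [hlt|[heq|hgt]]; [|exact heq|].
  - pose proof (H x x' ltac:(lra) h4'). lra.
  - pose proof (H x' x ltac:(lra) h4). lra.
Qed.

(** Zeros of 27 v + 2 y (1 - 2 v)^3 with v = p (1 + p) are the preimages of y,
    and this polynomial changes sign between p = 0 and p = 1/4. *)
Lemma cubic_arg_surjective y :
  - (1 / 2) < y < 0 -> exists p, 0 < p < 1 / 4 /\ cubic_arg p = y.
Proof.
  intros hy.
  destruct (Ranalysis5.IVT_interv
    (fun p => 27 * (p * (1 + p)) + 2 * y * (1 - 2 * (p * (1 + p))) ^ 3)
    0 (1 / 4)) as [p [hp h]].
  - intros p _. apply continuity_pt_filterlim.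
    apply (ex_derive_continuous
      (fun p => 27 * (p * (1 + p)) + 2 * y * (1 - 2 * (p * (1 + p))) ^ 3)).
    auto_derive. easy.
  - lra.
  - lra.
  - lra.
  - assert (p <> 0) by (intros ->; lra).
    assert (p <> 1 / 4) by (intros ->; lra).
    exists p. split; [lra|].
    unfold cubic_arg.
    replace (27 * (p * (1 + p)))
      with (- (2 * y * (1 - 2 * (p * (1 + p))) ^ 3)) by lra.
    field. nra.
Qed.

(** The square of 2 k k', where m = k^2. *)
Definition complementary_product (m : R) : R := 4 * (m * (1 - m)).

Lemma complementary_product_modulus_sqr p :
  1 + 2 * p <> 0 ->
  1 - 4 * complementary_product (modulus_sqr p)
  = (1 - 2 * (p * (1 + p)))
    * (1 + 6 * (p * (1 + p)) + 12 * (p * (1 + p)) ^ 2 - 8 * (p * (1 + p)) ^ 3)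
    / (1 + 2 * p) ^ 2.
Proof.
  intros hp. unfold complementary_product.
  rewrite one_minus_modulus_sqr by exact hp.
  unfold modulus_sqr. field. exact hp.
Qed.

(** If the modulus belongs to the period ratio tau, both sides are
    1728 / j at (tau + 1) / 2.  With v = p (1 + p), the numerators of 1 - 4 x
    and 9 - 8 y share the factor 1 + 6 v + 12 v^2 - 8 v^3, which then cancels. *)
Lemma cubic_arg_invariant p :
  0 < p < 1 / 4 ->
  let x := complementary_product (modulus_sqr p) in
  let y := cubic_arg p in
  0 < 1 - 4 * x /\
  64 * (y - 1) * y ^ 3 / (8 * y - 9) ^ 3 = - (27 * x / (1 - 4 * x) ^ 3).
Proof.
  intros hp x y.
  assert (hx := complementary_product_modulus_sqr p ltac:(lra)).
  fold x in hx.
  assert (hv : 0 < p * (1 + p) < 5 / 16) by nra.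
  assert (hu : 0 < 1 - 2 * (p * (1 + p))) by lra.
  assert (hw : 0 < 1 + 6 * (p * (1 + p)) + 12 * (p * (1 + p)) ^ 2
                 - 8 * (p * (1 + p)) ^ 3).
  { set (v := p * (1 + p)) in *. nra. }
  split.
  - rewrite hx. apply Rdiv_lt_0_compat; [|apply pow_lt; lra].
    apply Rmult_lt_0_compat; assumption.
  - rewrite hx.
    assert (hy : 8 * y - 9 = - (9 * (1 + 6 * (p * (1 + p)) + 12 * (p * (1 + p)) ^ 2
                 - 8 * (p * (1 + p)) ^ 3) / (1 - 2 * (p * (1 + p))) ^ 3)).
    { unfold y, cubic_arg. field. lra. }
    rewrite hy. unfold y, x, cubic_arg, complementary_product.
    rewrite one_minus_modulus_sqr by lra.
    unfold modulus_sqr.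
    set (W := 1 + 6 * (p * (1 + p)) + 12 * (p * (1 + p)) ^ 2
                 - 8 * (p * (1 + p)) ^ 3) in *.
    clearbody W.
    field. repeat split; lra.
Qed.

(** Choose p from y.  Then m and the value [modulus_sqr] p give the same
    invariant, hence the same x, hence the same m because neither of them
    exceeds 1/2. *)
Lemma parametrize_solution m y :
  0 < m <= 1 / 2 -> - (1 / 2) < y < 0 ->
  let x := complementary_product m in
  64 * (y - 1) * y ^ 3 / (8 * y - 9) ^ 3 = - (27 * x / (1 - 4 * x) ^ 3) ->
  exists p, 0 < p < 1 / 4 /\ m = modulus_sqr p /\ y = cubic_arg p.
Proof.
  intros hm hy x h.
  destruct (cubic_arg_surjective y hy) as [p [hp hpy]].
  exists p. split; [exact hp|]. split; [|symmetry; exact hpy].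
  destruct (cubic_arg_invariant p hp) as [hx' h'].
  assert (hm' := modulus_sqr_bounds p hp).
  assert (hx0 : 0 < x) by (unfold x, complementary_product; nra).
  assert (hx : x = complementary_product (modulus_sqr p)).
  { apply cubic_invariant_injective; trivial.
    - unfold complementary_product; nra.
    - apply (one_minus_4x_pos x y); assumption.
    - rewrite hpy in h'. lra. }
  unfold x, complementary_product in hx.
  (* Equality of the products leaves two cases: equal parameters, or
     complementary ones, which the bounds exclude. *)
  assert (hmul : (m - modulus_sqr p) * (1 - m - modulus_sqr p) = 0) by lra.
  apply Rmult_integral in hmul. lra.
Qed.

Lemma sqrt_one_minus_complementary_product m :
  m <= 1 / 2 -> sqrt (1 - complementary_product m) = 1 - 2 * m.
Proof.
  intros hm.
  replace (1 - complementary_product m) with ((1 - 2 * m) * (1 - 2 * m))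
    by (unfold complementary_product; ring).
  apply sqrt_square. lra.
Qed.

(** The square roots in the theorem combine to a rational function of p since
    (9 - 8 y) / (1 - 4 x) is the square of 3 (1 + 2 p) / (1 - 2 v)^2, where
    v = p (1 + p). *)
Lemma sqrt_multiplier_quotient p :
  0 < p < 1 / 4 ->
  let x := complementary_product (modulus_sqr p) in
  sqrt (9 - 8 * cubic_arg p) / sqrt ((1 - 4 * x) ^ 3)
  = 3 * (1 + 2 * p) / ((1 - 2 * (p * (1 + p))) ^ 2 * (1 - 4 * x)).
Proof.
  intros hp x.
  destruct (cubic_arg_invariant p hp) as [hx _]. fold x in hx.
  assert (hu : 0 < 1 - 2 * (p * (1 + p))) by nra.
  set (c := 3 * (1 + 2 * p) / (1 - 2 * (p * (1 + p))) ^ 2).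
  assert (hc : 0 < c).
  { apply Rdiv_lt_0_compat; [lra|]. apply pow_lt, hu. }
  assert (h9 : 9 - 8 * cubic_arg p = c * c * (1 - 4 * x)).
  { unfold x. rewrite complementary_product_modulus_sqr by lra.
    unfold c, cubic_arg. field. lra. }
  assert (hs := sqrt_lt_R0 _ hx).
  rewrite h9, sqrt_mult, sqrt_square by nra.
  replace ((1 - 4 * x) ^ 3) with ((1 - 4 * x) * (1 - 4 * x) * (1 - 4 * x)) by ring.
  rewrite sqrt_mult, sqrt_square by nra.
  unfold c. field. repeat split; lra.
Qed.

(** The factors 27 - 36 y + 8 y^2 and 1 + 8 x are the numerators of the
    logarithmic derivatives of the two sides of the equation between y and x.
    This identity is what removes 27 - 36 y + 8 y^2 from the constant a. *)
Lemma invariant_log_derivatives p :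
  0 < p < 1 / 4 ->
  let x := complementary_product (modulus_sqr p) in
  let y := cubic_arg p in
  (1 - 2 * modulus_sqr p) * (1 + 8 * x) * (y * (1 - y))
  = - (p * (1 + p) * ((1 - p) * (2 + p)) * (1 + 2 * p)) / 4
    * (27 - 36 * y + 8 * y ^ 2).
Proof.
  intros hp x y. unfold x, y, complementary_product, cubic_arg.
  rewrite one_minus_modulus_sqr by lra. unfold modulus_sqr.
  field. split; nra.
Qed.

(** The constant a of the theorem with all algebraic irrationalities expressed
    by p. *)
Lemma ramanujan_constant p s al :
  0 < p < 1 / 4 ->
  let m := modulus_sqr p in
  let x := complementary_product m in
  let y := cubic_arg p in
  sqrt (9 - 8 * y)
    / (6 * sqrt ((1 - 4 * x) ^ 3) * (27 - 36 * y + 8 * y ^ 2))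
  * (2 * (1 - 4 * x) * (27 - 36 * y + 8 * y ^ 2) * al
     + 4 * x * ((27 - 36 * y + 8 * y ^ 2)
                - (16 * y - 16 * y ^ 2) * sqrt (1 - x)) * s
     - ((27 - 36 * y + 8 * y ^ 2)
        - (27 - 44 * y + 16 * y ^ 2) * sqrt (1 - x)) * s)
  = (1 + 2 * p) / (1 - 2 * (p * (1 + p))) ^ 2
    * (al - s / 2
       + s * (1 - 2 * m + 2 * (p * (1 + p)) * ((1 - p) * (2 + p)) * (1 + 2 * p))
         / (2 * (1 - 4 * x))).
Proof.
  intros hp m x y.
  assert (hm := modulus_sqr_bounds p hp). fold m in hm.
  assert (hu : 0 < 1 - 2 * (p * (1 + p))) by nra.
  destruct (cubic_arg_invariant p hp) as [hx _]. fold m x in hx.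
  assert (hy := cubic_arg_neg p hp). fold y in hy.
  set (P := 27 - 36 * y + 8 * y ^ 2).
  assert (hP : 0 < P) by (unfold P; nra).
  assert (hq := sqrt_multiplier_quotient p hp). cbv zeta in hq.
  assert (hl := invariant_log_derivatives p hp). cbv zeta in hl.
  fold m in hl. fold x y in hl. fold P in hl.
  assert (hs : 0 < sqrt ((1 - 4 * x) ^ 3)) by (apply sqrt_lt_R0, pow_lt, hx).
  assert (hsq : sqrt (1 - x) = 1 - 2 * m)
    by (apply sqrt_one_minus_complementary_product; lra).
  rewrite hsq.
  replace (27 - 44 * y + 16 * y ^ 2) with (P - 8 * (y * (1 - y)))
    by (unfold P; ring).
  replace (sqrt (9 - 8 * y) / (6 * sqrt ((1 - 4 * x) ^ 3) * P))
    with (sqrt (9 - 8 * y) / sqrt ((1 - 4 * x) ^ 3) / (6 * P))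
    by (field; lra).
  fold m x y in hq. rewrite hq.
  replace (2 * (1 - 4 * x) * P * al
     + 4 * x * (P - (16 * y - 16 * y ^ 2) * (1 - 2 * m)) * s
     - (P - (P - 8 * (y * (1 - y))) * (1 - 2 * m)) * s)
    with (P * (2 * (1 - 4 * x) * al - (1 - 4 * x) * s + (1 - 2 * m) * s)
          - 8 * s * ((1 - 2 * m) * (1 + 8 * x) * (y * (1 - y)))) by ring.
  rewrite hl. field. repeat split; lra.
Qed.

(** The coefficient of s in the sum vanishes, and PI / (4 K^2) times the square
    of [cubic_solution] gives the value 1 / PI. *)
Lemma ramanujan_identity p s :
  0 < p < 1 / 4 ->
  let m := modulus_sqr p in
  let x := complementary_product m in
  let al := PI / (4 * K m ^ 2) - s * (E m / K m - 1) in
  (1 + 2 * p) / (1 - 2 * (p * (1 + p))) ^ 2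
    * (al - s / 2
       + s * (1 - 2 * m + 2 * (p * (1 + p)) * ((1 - p) * (2 + p)) * (1 + 2 * p))
         / (2 * (1 - 4 * x)))
  * cubic_solution p ^ 2
  + 1 / 3 * s * (2 * cubic_solution p * cubic_solution1 p) = 1 / PI.
Proof.
  intros hp m x al. pose proof PI_RGT_0.
  assert (hm := modulus_sqr_bounds p hp).
  assert (hK := K_pos (modulus_sqr p) ltac:(lra)).
  assert (hu : 0 < 1 - 2 * (p * (1 + p))) by nra.
  destruct (cubic_arg_invariant p hp) as [hx _].
  assert (ht : 0 < sqrt (1 + 2 * p)) by (apply sqrt_lt_R0; lra).
  assert (htt : sqrt (1 + 2 * p) ^ 2 = 1 + 2 * p) by (apply pow2_sqrt; lra).
  (* With v = p (1 + p), both numerators contain the factor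
     1 + 6 v + 12 v^2 - 8 v^3, which cancels. *)
  assert (hbr : (1 - 2 * m
     + 2 * (p * (1 + p)) * ((1 - p) * (2 + p)) * (1 + 2 * p)) / (1 - 4 * x)
     = (1 + 2 * p) / (1 - 2 * (p * (1 + p)))).
  { apply (Rmult_eq_reg_r (1 - 4 * x)); [|unfold x, m; lra].
    transitivity (1 - 2 * m
      + 2 * (p * (1 + p)) * ((1 - p) * (2 + p)) * (1 + 2 * p)).
    - field. unfold x, m; lra.
    - unfold x, m. rewrite complementary_product_modulus_sqr by lra.
      unfold modulus_sqr. field. split; lra. }
  replace (s * (1 - 2 * m
      + 2 * (p * (1 + p)) * ((1 - p) * (2 + p)) * (1 + 2 * p))
      / (2 * (1 - 4 * x))) with (s / 2 * ((1 + 2 * p) / (1 - 2 * (p * (1 + p))))).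
  2:{ rewrite <- hbr. field. unfold x, m; lra. }
  unfold al, cubic_solution, cubic_solution1. fold m in hK |- *.
  clear hbr. clearbody x m.
  set (t := sqrt (1 + 2 * p)) in *.
  field_simplify_eq; [|repeat split; lra].
  replace (t ^ 2) with (1 + 2 * p).
  ring.
Qed.

(* The hypothesis [1 <= r] (that is, lambda_star r <= 1 / sqrt 2) is needed:
   x, y and z are the same for r and 1 / r, but for 0 < r < 1 the series does
   not sum to 1 / PI; at r = 1 / 25 its sum is approximately 0.18727. *)
Theorem theorem3p1 (r x y z a b : R)
  (hr : 0 < r)
  (hr1 : 1 <= r)
  (hx : x = 4 * (lambda_star r ^ 2 - lambda_star r ^ 4))
  (hy : unique (fun t : R =>
          - (1 / 2) < t < 0 /\
          64 * (t - 1) * t ^ 3 / (8 * t - 9) ^ 3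
            = - (27 * x / (1 - 4 * x) ^ 3)) y)
  (hz : z = 4 * y * (1 - y))
  (ha : a =
     sqrt (9 - 8 * y)
       / (6 * sqrt ((1 - 4 * x) ^ 3) * (27 - 36 * y + 8 * y ^ 2))
     * (2 * (1 - 4 * x) * (27 - 36 * y + 8 * y ^ 2) * alpha r
        + 4 * x * ((27 - 36 * y + 8 * y ^ 2)
                   - (16 * y - 16 * y ^ 2) * sqrt (1 - x)) * sqrt r
        - ((27 - 36 * y + 8 * y ^ 2)
           - (27 - 44 * y + 16 * y ^ 2) * sqrt (1 - x)) * sqrt r))
  (hb : b = 1 / 3 * sqrt r * (1 - 2 * y))
  (hz1 : Rabs z < 1) :
  is_series
    (fun n : nat =>
       pochhammer (1 / 3) n * pochhammer (1 / 2) n * pochhammer (2 / 3) n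
         / pochhammer 1 n ^ 3 * z ^ n * (a + b * INR n))
    (1 / PI).
Proof.
  pose proof PI_RGT_0.
  destruct hy as [[hy0 hy1] _].
  assert (hm := lambda_star_sqr_bounds r hr1).
  assert (hal := alpha_by_E r hr1). cbv zeta in hal.
  replace (lambda_star r ^ 4) with (lambda_star r ^ 2 * lambda_star r ^ 2)
    in hx by ring.
  set (m := lambda_star r ^ 2) in *. clearbody m.
  assert (hx2 : x = complementary_product m)
    by (rewrite hx; unfold complementary_product; ring).
  clear hx. subst x.
  destruct (parametrize_solution m y hm hy0 hy1) as [p [hp [hmp hyp]]].
  subst m y.
  destruct (cubic_arg_invariant p hp) as [hx4 _].
  assert (hzp : z = series_arg p) by exact hz.
  clear hz. subst z.
  destruct (cubic_transformation p hp hz1) as [h0 h1].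
  replace (1 / PI) with
    (a * PSeries cubic_coeff (series_arg p)
     + b * PSeries (theta cubic_coeff) (series_arg p)).
  { exact (is_series_cubic a b (series_arg p) hz1). }
  unfold pullback in h0, h1.
  rewrite h0, hb.
  replace (1 / 3 * sqrt r * (1 - 2 * cubic_arg p)
           * PSeries (theta cubic_coeff) (series_arg p))
    with (1 / 3 * sqrt r * (2 * cubic_solution p * cubic_solution1 p))
    by (rewrite <- h1; ring).
  rewrite ha, hal, ramanujan_constant by exact hp.
  exact (ramanujan_identity p (sqrt r) hp).
Qed.
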